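(* Let $x^* \in \operatorname{dom} f$ be a point of local minimum of the problem $(\mathcal{P})$. Then the penalty function $F_\lambda$ is exact at $x^*$ if and only if the problem $(\mathcal{P}_{\mu_0})$ is $\beta$-calm at $x^*$.
   Context: Setting. Let $X$ be a topological space, $f \colon X \to \mathbb{R} \cup \{+\infty\}$ a function, and $M, A \subset X$ nonempty sets with $\Omega := M \cap A \neq \emptyset$. The problem $(\mathcal{P})$ is: minimize $f(x)$ subject to $x \in M$, $x \in A$ (so $\Omega$ is its feasible set, and a point of local minimum is a point $x^* \in \Omega$ with $f(x) \ge f(x^* )$ for all $x \in \Omega$ in some neighbourhood of $x^*$). It is assumed that $f$ is bounded below on $\Omega$. Write $\mathbb{R}_+ = [0,+\infty)$ and $\operatorname{dom} f = \{x \in X \mid f(x) < +\infty\}$. Let $(P,d)$ be a metric space, $\mu_0 \in P$, $B(\mu,r) = \{\nu \in P \mid d(\nu,\mu) \le r\}$, and let $g \colon X \times P \to \mathbb{R} \cup \{+\infty\}$ satisfy: (i) (consistency) $g(x,\mu_0) = f(x)$ for all $x \in \Omega$; (ii) (exact penalization) $\operatorname{arg\,min}_{x \in A} g(x,\mu_0) = \operatorname{arg\,min}_{x \in \Omega} f(x)$. Let $\beta \colon \mathbb{R}_+ \to \mathbb{R}_+ \cup \{+\infty\}$ be such that $\beta(t) = 0$ if and only if $t = 0$. For $\lambda \ge 0$ the penalty function is $$F_\lambda(x,\mu) = g(x,\mu) + \lambda \beta(d(\mu,\mu_0)), \quad (x,\mu) \in X \times P,$$ with the convention $0 \cdot (+\infty)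 = 0$. Exactness at a point: for a point of local minimum $x^* \in \operatorname{dom} f$ of $(\mathcal{P})$, $F_\lambda$ is called (locally) exact at $x^*$ if there exists $\lambda \ge 0$ such that $(x^*,\mu_0)$ is a point of local minimum of $F_\lambda$ on $A \times P$. Perturbed problem: for $\mu \in P$, $(\mathcal{P}_\mu)$ is the problem of minimizing $g(x,\mu)$ over $x \in A$. The problem $(\mathcal{P}_{\mu_0})$ is called $\beta$-calm at a point $x^* \in A$ if there exist $\lambda \ge 0$, $r > 0$ and a neighbourhood $U$ of $x^*$ such that $$g(x,\mu) - g(x^*,\mu_0) \ge -\lambda \beta(d(\mu,\mu_0)) \quad \forall x \in U \cap A, \ \forall \mu \in B(\mu_0,r).$$ *)

(* Defs.v *)
From mathcomp Require Import all_boot all_order all_algebra.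
From mathcomp Require Import boolp classical_sets reals ereal interval_inference.
From mathcomp Require Import topology normedtype.

Set Implicit Arguments.
Unset Strict Implicit.
Unset Printing Implicit Defensive.

Import Order.TTheory GRing.Theory Num.Theory.

Local Open Scope classical_set_scope.
Local Open Scope ring_scope.
Local Open Scope ereal_scope.

(* Functions with values in R `|` {+oo} are functions to \bar R that avoid -oo
   (the latter being a hypothesis wherever it is used). *)

Definition dom (R : realType) (T : Type) (h : T -> \bar R) : set T :=
  [set x | h x < +oo].

Definition argmin (R : realType) (T : Type) (D : set T) (h : T -> \bar R) :
    set T :=
  [set x | D x /\ forall y, D y -> h x <= h y].

Definition local_min (R : realType) (T : topologicalType) (D : set T)
    (h : T -> \bar R) (x : T) : Prop :=
  D x /\ \forall y \near x, D y -> h x <= h y.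

Definition closed_mball (R : realType) (P : metricType R) (mu : P) (r : R) :
    set P :=
  [set nu | (mdist nu mu <= r)%R].

(* In \bar R, 0 * +oo = 0, so F_0 = g even where beta is infinite. Only the
   values of beta on [0, +oo[ matter, since mdist is nonnegative. *)
Definition penalty (R : realType) (X : topologicalType) (P : metricType R)
    (mu0 : P) (g : X * P -> \bar R) (beta : R -> \bar R) (lambda : R) :
    X * P -> \bar R :=
  fun p => g p + lambda%:E * beta (mdist p.2 mu0).

Definition exact_at (R : realType) (X : topologicalType) (P : metricType R)
    (A : set X) (mu0 : P) (g : X * P -> \bar R) (beta : R -> \bar R) (xs : X) :
    Prop :=
  exists2 lambda : R, (0 <= lambda)%R &
    local_min (A `*` [set: P]) (penalty mu0 g beta lambda) (xs, mu0).

Definition calm_at (R : realType) (X : topologicalType) (P : metricType R)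
    (A : set X) (mu0 : P) (g : X * P -> \bar R) (beta : R -> \bar R) (xs : X) :
    Prop :=
  exists (lambda r : R) (U : set X),
    [/\ (0 <= lambda)%R, (0 < r)%R, nbhs xs U &
      forall x mu, (U `&` A) x -> closed_mball mu0 r mu ->
        - (lambda%:E * beta (mdist mu mu0)) <= g (x, mu) - g (xs, mu0)].

(* Main.v *)
Require Import Defs.
From mathcomp Require Import all_boot all_order all_algebra.
From mathcomp Require Import boolp classical_sets reals ereal interval_inference.
From mathcomp Require Import topology normedtype.

Import Order.TTheory GRing.Theory Num.Theory.

Local Open Scope classical_set_scope.
Local Open Scope ring_scope.
Local Open Scope ereal_scope.

(** Both exactness and calmness bound [g (xs, mu0)] by [g] plus a multiple of
[beta] of the distance to [mu0], near [(xs, mu0)] and over [x \in A]: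
- because [beta 0 = 0], the penalty function takes the value [g (xs, mu0)] at
  [(xs, mu0)], so its local minimality there says
  [g (xs, mu0) <= g (x, mu) + lambda * beta (mdist mu mu0)] for [(x, mu)] near
  [(xs, mu0)];
- calmness is the same inequality with the two terms moved across, which is
  legitimate in the extended reals because [g (xs, mu0) = f xs] is finite and
  [-oo] never occurs ([leeN_sube]).
The neighbourhoods correspond as well: the sets [U `*` closed_mball mu0 r] form
a basis of neighbourhoods of [(xs, mu0)] ([nbhs_closed_mball],
[closed_mball_sub_nbhs]), and the same [lambda] serves in both directions. *)

Lemma nbhs_closed_mball {R : realType} {P : metricType R} {mu : P} {r : R} :
  (0 < r)%R -> nbhs mu (closed_mball mu r).
Proof.
move=> r0; apply: filterS (nbhsx_ballx mu r r0) => nu.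
by rewrite ballEmdist/= /closed_mball/= metric_sym => /ltW.
Qed.

Lemma closed_mball_sub_nbhs {R : realType} {P : metricType R} {mu : P}
    {V : set P} :
  nbhs mu V -> exists2 r : R, (0 < r)%R & closed_mball mu r `<=` V.
Proof.
move=> /nbhs_ballP[e /= e0 eV]; exists (e / 2)%R; first by rewrite divr_gt0.
move=> nu; rewrite /closed_mball/= metric_sym => nu_e2; apply: eV.
by rewrite ballEmdist/= (le_lt_trans nu_e2)// ltr_pdivrMr// ltr_pMr// ltr1n.
Qed.

(** Only [a] has to be finite: when [b = +oo] both inequalities hold, the right
one because [x + +oo = +oo] as soon as [x] is not [-oo]. *)
Lemma leeN_sube (R : realDomainType) (a b x : \bar R) :
  a \is a fin_num -> b != -oo -> x != -oo ->
  (- b <= x - a) = (a <= x + b).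
Proof.
move=> a_fin; case: b => [b| |//] _ x_proper.
  by rewrite leeBrDr// addeC leeBlDr.
by rewrite addey// leNye leey.
Qed.

Lemma penalty_center (R : realType) (X : topologicalType) (P : metricType R)
    (mu0 : P) (g : X * P -> \bar R) (beta : R -> \bar R) (lambda : R) (x : X) :
  beta 0%R = 0 -> penalty mu0 g beta lambda (x, mu0) = g (x, mu0).
Proof. by move=> beta0; rewrite /penalty/= mdistxx beta0 mule0 adde0. Qed.

Theorem proposition1 (R : realType) (X : topologicalType) (f : X -> \bar R)
  (M A : set X) (P : metricType R) (mu0 : P) (g : X * P -> \bar R)
  (beta : R -> \bar R) (xs : X)
  (f_proper : forall x, f x != -oo)
  (M_neq0 : M !=set0) (A_neq0 : A !=set0) (Omega_neq0 : M `&` A !=set0)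
  (f_bounded_below : exists m : R, forall x, (M `&` A) x -> m%:E <= f x)
  (g_proper : forall p, g p != -oo)
  (g_consistent : forall x, (M `&` A) x -> g (x, mu0) = f x)
  (g_exact : argmin A (fun x => g (x, mu0)) = argmin (M `&` A) f)
  (beta_ge0 : forall t : R, (0 <= t)%R -> 0 <= beta t)
  (beta_eq0 : forall t : R, (0 <= t)%R -> (beta t = 0 <-> t = 0%R))
  (xs_dom : dom f xs)
  (xs_min : local_min (M `&` A) f xs) :
  exact_at A mu0 g beta xs <-> calm_at A mu0 g beta xs.
Proof.
have beta0 : beta 0%R = 0 by apply/beta_eq0.
have [Oxs _] := xs_min.
have [_ Axs] := Oxs.
have gxs_fin : g (xs, mu0) \is a fin_num.
  by rewrite g_consistent// fin_numE f_proper/= -ltey.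
have calmE (lambda : R) x mu : (0 <= lambda)%R ->
    (- (lambda%:E * beta (mdist mu mu0)) <= g (x, mu) - g (xs, mu0)) =
    (penalty mu0 g beta lambda (xs, mu0) <= penalty mu0 g beta lambda (x, mu)).
  move=> lambda0; rewrite penalty_center// leeN_sube//.
  have : 0 <= lambda%:E * beta (mdist mu mu0).
    by rewrite mule_ge0// beta_ge0// mdist_ge0.
  by case: (_ * _).
split.
- move=> [lambda lambda0 [_ [[U V] /= [xsU mu0V] UVmin]]].
  have [r r0 rV] := closed_mball_sub_nbhs mu0V.
  exists lambda, r, U; split=> // x mu [Ux Ax] /rV Vmu.
  by rewrite calmE//; apply: (UVmin (x, mu)).
- move=> [lambda [r [U [lambda0 r0 xsU calm]]]].
  exists lambda => //; split; first by split.
  exists (U, closed_mball mu0 r) => /=.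
    by split=> //; apply: nbhs_closed_mball.
  by move=> [x mu] [/= Ux rmu] [/= Ax _]; rewrite -calmE//; apply: calm.
Qed.
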